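(* Let $(\mathbf{A},\mathbf{E})$ be a regular matrix pencil, $\mathbf{A},\mathbf{E}\in\mathbb{C}^{n\times n}$, all of whose finite eigenvalues have strictly negative real part, and let $\mu\in\mathbb{C}$ be such that $\mathbf{A}-\mu\mathbf{E}$ is invertible. Then for all $\varepsilon>0$, $$\sup_{t\ge0}\big\|\mathrm{e}^{t(\mathbf{G}_\mu^{-1}+\mu\mathbf{I})}\big\|\ge\frac{\alpha_\varepsilon(\mathbf{A},\mathbf{E})}{\varepsilon},$$ and there exists some nonzero $\mathbf{x}(0)\in\mathrm{Ran}(\mathbf{Q}_\mu)$ such that the solution $\mathbf{x}(t)$ of $\mathbf{E}\mathbf{x}'(t)=\mathbf{A}\mathbf{x}(t)$ satisfies $$\sup_{t\ge0}\frac{\|\mathbf{x}(t)\|}{\|\mathbf{x}(0)\|}\ge\frac{\alpha_\varepsilon(\mathbf{A},\mathbf{E})}{\varepsilon}.$$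
   Context: $\|\cdot\|$ is the Euclidean vector norm and the matrix norm it induces, with the convention $\|\mathbf{X}^{-1}\|=\infty$ when $\mathbf{X}$ is a square matrix that is not invertible. The pencil $(\mathbf{A},\mathbf{E})$ is regular if $\mathbf{A}-\mu\mathbf{E}$ is invertible for some $\mu\in\mathbb{C}$; its finite eigenvalues are the $\lambda\in\mathbb{C}$ with $\mathbf{A}-\lambda\mathbf{E}$ singular. $\mathrm{Ran}(\cdot)$ is the column space. For $\mu\in\mathbb{C}$ with $\mathbf{A}-\mu\mathbf{E}$ invertible, let $\mathbf{E}_\mu:=(\mathbf{A}-\mu\mathbf{E})^{-1}\mathbf{E}$, let $d$ be the algebraic multiplicity of $0$ as an eigenvalue of $\mathbf{E}_\mu$ (with $d<n$ understood, so that $\mathbf{G}_\mu$ below is not empty), and take a Schur factorization $$\mathbf{E}_\mu=[\mathbf{Q}_\mu\ \widetilde{\mathbf{Q}}_\mu]\begin{bmatrix}\mathbf{G}_\mu&\mathbf{D}_\mu\\ \mathbf{0}&\mathbf{N}_\mu\end{bmatrix}[\mathbf{Q}_\mu\ \widetilde{\mathbf{Q}}_\mu]^*$$ with $[\mathbf{Q}_\mu\ \widetilde{\mathbf{Q}}_\mu]$ unitary, $\mathbf{Q}_\mu\in\mathbb{C}^{n\times(n-d)}$, the middle factor upper triangular, $\mathbf{N}_\mu\in\mathbb{C}^{d\times d}$ nilpotent, and $\mathbf{G}_\mu\in\mathbb{C}^{(n-d)\times(n-d)}$ with $0\notin\sigma(\mathbf{G}_\mu)$. The initial conditions consistent with the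 differential-algebraic equation $\mathbf{E}\mathbf{x}'(t)=\mathbf{A}\mathbf{x}(t)$ are exactly those $\mathbf{x}(0)\in\mathrm{Ran}(\mathbf{Q}_\mu)$, and each such $\mathbf{x}(0)$ determines a unique solution. The $\varepsilon$-pseudospectrum of the pencil is $\sigma_\varepsilon(\mathbf{A},\mathbf{E}):=\{z\in\mathbb{C}:\|(z\mathbf{I}-(\mathbf{G}_\mu^{-1}+\mu\mathbf{I}))^{-1}\|>1/\varepsilon\}$ (independent of $\mu$), and the $\varepsilon$-pseudospectral abscissa is $\alpha_\varepsilon(\mathbf{A},\mathbf{E}):=\sup_{z\in\sigma_\varepsilon(\mathbf{A},\mathbf{E})}\mathrm{Re}\,z$. *)

(* Defs.v *)
From HB Require Import structures.
From mathcomp Require Import all_boot all_order all_algebra.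
From mathcomp Require Import all_classical all_reals all_analysis.
From mathcomp Require Import complex.

Set Implicit Arguments.
Unset Strict Implicit.
Unset Printing Implicit Defensive.

Import Order.TTheory GRing.Theory Num.Theory.
Import numFieldNormedType.Exports.

Local Open Scope classical_set_scope.
Local Open Scope ring_scope.
Local Open Scope complex_scope.
Local Open Scope sesquilinear_scope.

(* The modulus topology on [R[i]]; matrices over [R[i]] then inherit the
   entrywise topology from the library. *)
HB.instance Definition _ (R : realType) :=
  PseudoPointedMetric.copy R[i] (R[i]^o).
HB.instance Definition _ (R : realType) := NormedModule.copy R[i] (R[i]^o).

Section Norms.
Variable R : realType.

(* The library norm on matrices is the max norm (and is [R[i]]-valued). *)
Definition norm2 (n : nat) (v : 'cV[R[i]]_n) : R :=
  Num.sqrt (\sum_(i < n) Normc.normc (v i 0) ^+ 2).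

Definition opnorm (m n : nat) (M : 'M[R[i]]_(m, n)) : R :=
  sup [set norm2 (M *m x) | x in [set x : 'cV[R[i]]_n | norm2 x <= 1]].

(* ||M^-1||, with the value +oo when M is singular. *)
Definition opnorm_inv (n : nat) (M : 'M[R[i]]_n) : \bar R :=
  if M \in unitmx then (opnorm (invmx M))%:E else +oo%E.

Definition expmx (n : nat) (M : 'M[R[i]]_n) : 'M[R[i]]_n :=
  limn (series (fun k : nat => (k`!%:R)^-1 *: M ^+ k)).

End Norms.

Section Pencils.
Variables (R : realType) (n : nat).
Implicit Types A E : 'M[R[i]]_n.

Definition regular_pencil A E : Prop :=
  exists mu : R[i], A - mu *: E \in unitmx.

Definition finite_eigenvalue A E (lam : R[i]) : Prop :=
  A - lam *: E \notin unitmx.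

(* E_mu *)
Definition shift_invert A E (mu : R[i]) : 'M[R[i]]_n :=
  invmx (A - mu *: E) *m E.

(* [row_mx Q Qt] has type ['M_(n, n - d + d)]; for d <= n it is square up to
   this identification of dimensions, so that [unitarymx] means unitary. *)
Definition schur_splitting (M : 'M[R[i]]_n) (d : nat)
    (Q : 'M[R[i]]_(n, n - d)) (Qt : 'M[R[i]]_(n, d))
    (G : 'M[R[i]]_(n - d)) (D : 'M[R[i]]_(n - d, d)) (N : 'M[R[i]]_d) : Prop :=
  let U := row_mx Q Qt in
  let T := block_mx G D 0 N in
  [/\ d = mup 0 (char_poly M),
      U \is unitarymx /\ M = U *m T *m U^t*,
      (* [is_trig_mx] is lower triangularity *)
      is_trig_mx T^T,
      exists k : nat, N ^+ k = 0
    & ~~ eigenvalue G 0].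

(* [v] is the derivative of [x] at [t] relative to [0, +oo[, hence one-sided
   at t = 0. *)
Definition deriv_ge0 (x : R -> 'cV[R[i]]_n) (t : R) (v : 'cV[R[i]]_n) : Prop :=
  (fun h : R => (h^-1)%:C *: (x (t + h) - x t))
    @ within [set h : R | 0 <= t + h] 0^' --> v.

(* Solutions of E x' = A x on [0, +oo[; values of [x] at t < 0 are ignored. *)
Definition dae_solution A E (x : R -> 'cV[R[i]]_n) : Prop :=
  forall t : R, 0 <= t ->
    exists2 v : 'cV[R[i]]_n, deriv_ge0 x t v & E *m v = A *m x t.

End Pencils.

Section Pseudospectra.
Variables (R : realType) (m : nat).

(* The pseudospectrum and the pseudospectral abscissa of the pencil (A, E) are
   expressed through the leading block G of a Schur splitting of E_mu. *)
Definition pencil_pseudospectrum (G : 'M[R[i]]_m) (mu : R[i]) (eps : R) :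
    set R[i] :=
  [set z | ((eps^-1)%:E < opnorm_inv (z%:M - (invmx G + mu%:M))%R)%E].

Definition pencil_abscissa (G : 'M[R[i]]_m) (mu : R[i]) (eps : R) : \bar R :=
  ereal_sup [set (complex.Re z)%:E | z in pencil_pseudospectrum G mu eps].

End Pseudospectra.

(* Main.v *)
(* Put B = G^-1 + mu I. A point z of the pseudospectrum yields a unit vector u
   with |w| <= eps for w = (z - B) u. If a = Re z > 0 and |e^{tB} w| <= S for
   all t >= 0, then X = e^{tB} u solves X' = z X - e^{tB} w, so |u| > S / a would
   make X unbounded, whereas X = (z - B)^-1 e^{tB} w is bounded; hence
   sup_t |e^{tB} w| >= a |u| >= (a / eps) |w|. (If z is an eigenvalue of B, an
   eigenvector grows like e^{at}.) The pairs (z, u) form a compact set, so Re z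
   has a maximum on it, which bounds the abscissa and gives one initial vector
   for the whole supremum. *)

Require Import Defs.
From HB Require Import structures.
From mathcomp Require Import all_boot all_order all_algebra.
From mathcomp Require Import all_classical all_reals all_analysis.
From mathcomp Require Import complex.
From mathcomp Require Import ring lra.

Set Implicit Arguments.
Unset Strict Implicit.
Unset Printing Implicit Defensive.

Import Order.TTheory GRing.Theory Num.Theory.
Import numFieldNormedType.Exports.

Local Open Scope classical_set_scope.
Local Open Scope ring_scope.
Local Open Scope complex_scope.

(** The classical argument bounds the resolvent by the Laplace integral of [e^{tB}]. Here a
    differential inequality for the squared norm of one orbit replaces the integral, and it names
    the initial vector at once. The pseudospectrum is cut out by a strict inequality, so its
    supremum need not be attained there; relaxing it to [<=] on the pairs is what makes a maximum
    available. The growth argument needs [Re z > 0]. If the pseudospectrum has no such point, the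
    abscissa is at most 0 and the value 1 of the orbit ratio at [t = 0] suffices. The passage to the
    pencil rests on [E Q B = A Q] and on [Q] being an isometry: [Q e^{tB} y] is a solution with the
    same norms as [e^{tB} y]. Its uniqueness is a separate matter, settled in the Schur coordinates:
    the nilpotent block kills one component, the other obeys [p' = B p]. Time is real while matrices
    are complex, so all calculus is done on real and imaginary parts of entries. *)

Section ComplexCoordinates.
Variable R : realType.
Implicit Types z w : R[i].

Lemma ReD z w : complex.Re (z + w) = complex.Re z + complex.Re w.
Proof. by case: z w => [a b] [c d]. Qed.

Lemma ImD z w : complex.Im (z + w) = complex.Im z + complex.Im w.
Proof. by case: z w => [a b] [c d]. Qed.

Lemma ReN z : complex.Re (- z) = - complex.Re z.
Proof. by case: z => [a b]. Qed.

Lemma ImN z : complex.Im (- z) = - complex.Im z.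
Proof. by case: z => [a b]. Qed.

Lemma ReM z w : complex.Re (z * w) =
  complex.Re z * complex.Re w - complex.Im z * complex.Im w.
Proof. by case: z w => [a b] [c d]. Qed.

Lemma ImM z w : complex.Im (z * w) =
  complex.Re z * complex.Im w + complex.Im z * complex.Re w.
Proof. by case: z w => [a b] [c d]. Qed.

Lemma Re_sum (I : Type) (r : seq I) (P : pred I) (F : I -> R[i]) :
  complex.Re (\sum_(i <- r | P i) F i) = \sum_(i <- r | P i) complex.Re (F i).
Proof. exact: (big_morph _ ReD). Qed.

Lemma Im_sum (I : Type) (r : seq I) (P : pred I) (F : I -> R[i]) :
  complex.Im (\sum_(i <- r | P i) F i) = \sum_(i <- r | P i) complex.Im (F i).
Proof. exact: (big_morph _ ImD). Qed.

Lemma ReZ (a : R) z : complex.Re (a%:C * z) = a * complex.Re z.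
Proof. by rewrite ReM /= mul0r subr0. Qed.

Lemma ImZ (a : R) z : complex.Im (a%:C * z) = a * complex.Im z.
Proof. by rewrite ImM /= mul0r addr0. Qed.

Lemma sqr_normcE z :
  Normc.normc z ^+ 2 = complex.Re z ^+ 2 + complex.Im z ^+ 2.
Proof. by case: z => a b /=; rewrite sqr_sqrtr// addr_ge0// sqr_ge0. Qed.

Lemma normcRe z : `|complex.Re z| <= Normc.normc z.
Proof.
case: z => a b /=; rewrite -sqrtr_sqr ler_wsqrtr//.
by rewrite lerDl sqr_ge0.
Qed.

Lemma normcIm z : `|complex.Im z| <= Normc.normc z.
Proof.
case: z => a b /=; rewrite -sqrtr_sqr ler_wsqrtr//.
by rewrite lerDr sqr_ge0.
Qed.

Lemma normc_le z : Normc.normc z <= `|complex.Re z| + `|complex.Im z|.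
Proof.
case: z => a b /=; rewrite -[leRHS]ger0_norm ?addr_ge0// -sqrtr_sqr.
rewrite ler_wsqrtr// sqrrD !real_normK ?num_real//.
by rewrite addrAC lerDl mulrn_wge0// mulr_ge0.
Qed.

Lemma continuous_Re : continuous (@complex.Re R : R[i] -> R).
Proof.
move=> z A /nbhs_ballP[e /= e0 Ae].
apply/nbhs_ballP; exists e%:C; first by rewrite /= ltcR.
move=> w; rewrite /ball /= => zw; apply: Ae; rewrite /ball /=.
have : `|complex.Re (z - w)|%:C <= `|z - w| by exact: normc_ge_Re.
by move=> /le_lt_trans/(_ zw); rewrite ltcR ReD ReN.
Qed.

Lemma continuous_Im : continuous (@complex.Im R : R[i] -> R).
Proof.
move=> z A /nbhs_ballP[e /= e0 Ae].
apply/nbhs_ballP; exists e%:C; first by rewrite /= ltcR.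
move=> w; rewrite /ball /= => zw; apply: Ae; rewrite /ball /=.
have : `|complex.Im (z - w)|%:C <= `|z - w|.
  by rewrite /Num.norm/= lecR; exact: normcIm.
by move=> /le_lt_trans/(_ zw); rewrite ltcR ImD ImN.
Qed.

Lemma cvg_complexP (T : Type) (F : set_system T) {FF : Filter F}
    (f : T -> R[i]) (l : R[i]) :
  f @ F --> l <->
  (fun x => complex.Re (f x)) @ F --> complex.Re l /\
  (fun x => complex.Im (f x)) @ F --> complex.Im l.
Proof.
split=> [fl|[/cvgrPdist_lt fr /cvgrPdist_lt fi]].
  by split; apply: cvg_comp fl _; [exact: continuous_Re|exact: continuous_Im].
(* Radii of balls in [R[i]] are complex numbers; positivity forces the imaginary part [e'] to be
   0. *)
move=> A /nbhs_ballP[[e e']]; rewrite /= ltcE /= => /andP[/eqP -> e0] Ae.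
have e20 : 0 < e / 2 by rewrite divr_gt0.
rewrite nbhs_filterE; apply: filterS2 (fr _ e20) (fi _ e20) => x xr xi.
apply: (Ae (f x)); rewrite /ball/= /Num.norm/= ltcR.
apply: le_lt_trans (normc_le _) _; rewrite ReD ReN ImD ImN.
by rewrite (splitr e) ltrD.
Qed.

End ComplexCoordinates.

(** A neighbourhood of a matrix contains a product of neighbourhoods of its entries, and a filter is
    stable under the finitely many intersections involved. *)
Lemma cvg_mxP (U : topologicalType) (m n : nat) (T : Type)
    (F : set_system T) {FF : Filter F} (f : T -> 'M[U]_(m, n)) (L : 'M[U]_(m, n)) :
  f @ F --> L <-> forall i j, (fun x => f x i j) @ F --> L i j.
Proof.
split=> [fL i j A LA|fL A [P LP PA]].
  suff : nbhs L [set M : 'M[U]_(m, n) | A (M i j)] by exact: fL.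
  (* This product constrains the entry [(i, j)] alone; at all other positions the condition is
     vacuous. *)
  exists (fun i' j' => [set u | i' = i -> j' = j -> A u]) => /=.
    move=> i' j'; have [->|ni] := eqVneq i' i; last first.
      by apply: filterS filterT => x _ /eqP; rewrite (negbTE ni).
    have [->|nj] := eqVneq j' j; last first.
      by apply: filterS filterT => x _ _ /eqP; rewrite (negbTE nj).
    by apply: filterS LA => x + _ _; exact.
  by move=> M /(_ i j); apply.
rewrite nbhs_filterE.
have : \forall x \near F, forall ij : 'I_m * 'I_n, P ij.1 ij.2 (f x ij.1 ij.2).
  by apply: filter_forall => -[i j] /=; exact: fL.
by apply: filterS => x Px; apply: PA => i j; exact: Px (i, j).
Qed.

(** * Derivatives of complex matrices with respect to real time *)

Section MatrixDerivative.
Variable R : realType.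

Lemma is_derive1_quotient (f : R -> R) (t l : R) :
  is_derive t 1 f l <-> (fun h => h^-1 * (f (t + h) - f t)) @ (0 : R)^' --> l.
Proof.
have E : (fun h => h^-1 * (f (t + h) - f t)) =
         (fun h => h^-1 *: ((f \o shift t) (h *: 1) - f t)).
  by apply/funext => h /=; rewrite [h *: 1]mulr1 (addrC h).
split=> [[df <-]|].
  by rewrite E; exact: df.
rewrite E => fl; apply: DeriveDef; first by apply/cvg_ex; exists l.
by apply/cvg_lim.
Qed.

(** Write [f (t + h)] as [f t] plus [h] times the difference quotient: the product tends to
    [0 * l]. *)
Lemma quotient_cvg_right (f : R -> R) (t l : R) :
  (fun h => h^-1 * (f (t + h) - f t)) @ within [set h | 0 <= h] (0 : R)^' --> l ->
  f @ t^'+ --> f t.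
Proof.
set W := within _ _ => fl.
have W0 : (fun h : R => h) @ W --> (0 : R).
  apply: cvg_trans (_ : (0 : R)^' --> (0 : R)); first exact: cvg_within.
  exact: nbhs_dnbhs.
have : (fun h => f t + h * (h^-1 * (f (t + h) - f t))) @ W --> f t + 0 * l.
  by apply: cvgD; [exact: cvg_cst|exact: cvgM].
rewrite mul0r addr0 => ft A /ft /=; rewrite /W /dnbhs.
move=> /nbhs_ballP[e /= e0 He].
apply/nbhs_ballP; exists e => //= y yt ty.
have := He (y - t); rewrite /ball/= sub0r opprB => /(_ yt).
move=> /(_ _)/(_ _).
have yt0 : y - t != 0 by rewrite subr_eq0 gt_eqF.
move=> /(_ yt0); rewrite subr_ge0 => /(_ (ltW ty)).
by rewrite mulVKf// addrC [t + _]addrC !subrK.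
Qed.

(** Splitting entries into two real functions gives access to the calculus of functions from [R] to
    [R]. *)
Definition mderiv (m n : nat) (X : R -> 'M[R[i]]_(m, n)) (t : R)
    (V : 'M[R[i]]_(m, n)) : Prop :=
  forall i j,
    is_derive t 1 (fun s => complex.Re (X s i j)) (complex.Re (V i j)) /\
    is_derive t 1 (fun s => complex.Im (X s i j)) (complex.Im (V i j)).

Lemma mderivMl (l m n : nat) (M : 'M[R[i]]_(l, m))
    (X : R -> 'M[R[i]]_(m, n)) (t : R) (V : 'M[R[i]]_(m, n)) :
  mderiv X t V -> mderiv (fun s => M *m X s) t (M *m V).
Proof.
move=> XV i j; split.
- have -> : (fun s => complex.Re ((M *m X s) i j)) =
    \sum_k ((complex.Re (M i k) \*: (fun s => complex.Re (X s k j)) : R -> R) -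
            (complex.Im (M i k) \*: (fun s => complex.Im (X s k j)) : R -> R)).
    apply/funext => s; rewrite mxE Re_sum fct_sumE.
    by apply: eq_bigr => k _; rewrite ReM.
  rewrite mxE Re_sum; apply: is_derive_sum => k; rewrite ReM.
  by have [? ?] := XV k j; apply: is_deriveB; apply: is_deriveZ.
- have -> : (fun s => complex.Im ((M *m X s) i j)) =
    \sum_k ((complex.Re (M i k) \*: (fun s => complex.Im (X s k j)) : R -> R) +
            (complex.Im (M i k) \*: (fun s => complex.Re (X s k j)) : R -> R)).
    apply/funext => s; rewrite mxE Im_sum fct_sumE.
    by apply: eq_bigr => k _; rewrite ImM.
  rewrite mxE Im_sum; apply: is_derive_sum => k; rewrite ImM.
  by have [? ?] := XV k j; apply: is_deriveD; apply: is_deriveZ.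
Qed.

Lemma mderivMr (l m n : nat) (M : 'M[R[i]]_(m, n))
    (X : R -> 'M[R[i]]_(l, m)) (t : R) (V : 'M[R[i]]_(l, m)) :
  mderiv X t V -> mderiv (fun s => X s *m M) t (V *m M).
Proof.
move=> XV i j.
have XVT : mderiv (fun s => (X s)^T) t V^T.
  move=> k k'; rewrite mxE; under eq_fun do rewrite mxE.
  under [X in _ /\ is_derive _ _ X _]eq_fun do rewrite mxE.
  exact: XV.
have := mderivMl M^T XVT j i; rewrite -trmx_mul mxE.
by under eq_fun do rewrite -trmx_mul mxE;
  under [X in _ /\ is_derive _ _ X _]eq_fun do rewrite -trmx_mul mxE.
Qed.

Lemma mderivB (m n : nat) (X Y : R -> 'M[R[i]]_(m, n)) t V W :
  mderiv X t V -> mderiv Y t W -> mderiv (fun s => X s - Y s) t (V - W).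
Proof.
move=> XV YW i j; have [? ?] := XV i j; have [? ?] := YW i j; split.
- rewrite !mxE ReD ReN.
  under eq_fun do rewrite !mxE ReD ReN.
  exact: is_deriveB.
- rewrite !mxE ImD ImN.
  under eq_fun do rewrite !mxE ImD ImN.
  exact: is_deriveB.
Qed.

Lemma sqr_norm2E (n : nat) (v : 'cV[R[i]]_n) :
  norm2 v ^+ 2 = \sum_i (complex.Re (v i 0) ^+ 2 + complex.Im (v i 0) ^+ 2).
Proof.
rewrite sqr_sqrtr; last by apply: sumr_ge0 => i _; rewrite sqr_ge0.
by apply: eq_bigr => i _; rewrite sqr_normcE.
Qed.

Lemma is_derive_sqr_norm2 (n : nat) (X : R -> 'cV[R[i]]_n) (t : R) V :
  mderiv X t V -> is_derive t 1 (fun s => norm2 (X s) ^+ 2)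
    (\sum_i 2 * (complex.Re (X t i 0) * complex.Re (V i 0) +
                 complex.Im (X t i 0) * complex.Im (V i 0))).
Proof.
move=> XV; have -> : (fun s => norm2 (X s) ^+ 2) =
    \sum_i ((fun s => complex.Re (X s i 0)) ^+ 2 +
            (fun s => complex.Im (X s i 0)) ^+ 2 : R -> R).
  by apply/funext => s; rewrite sqr_norm2E fct_sumE.
apply: is_derive_sum => i; have [? ?] := XV i 0.
apply: is_derive_eq.
rewrite /= !expr1 mulrDr !mulrA; congr (_ + _).
Qed.

Lemma deriv_ge0P (n : nat) (x : R -> 'cV[R[i]]_n) (t : R) v :
  deriv_ge0 x t v <-> forall i,
   (fun h => h^-1 * (complex.Re (x (t + h) i 0) - complex.Re (x t i 0)))
     @ within [set h | 0 <= t + h] (0 : R)^' --> complex.Re (v i 0) /\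
   (fun h => h^-1 * (complex.Im (x (t + h) i 0) - complex.Im (x t i 0)))
     @ within [set h | 0 <= t + h] (0 : R)^' --> complex.Im (v i 0).
Proof.
have ReE i : (fun h => h^-1 * (complex.Re (x (t + h) i 0) - complex.Re (x t i 0)))
  = (fun h => complex.Re (((h^-1)%:C *: (x (t + h) - x t)) i 0)).
  by apply/funext => h; rewrite !mxE ReZ ReD ReN.
have ImE i : (fun h => h^-1 * (complex.Im (x (t + h) i 0) - complex.Im (x t i 0)))
  = (fun h => complex.Im (((h^-1)%:C *: (x (t + h) - x t)) i 0)).
  by apply/funext => h; rewrite !mxE ImZ ImD ImN.
split=> [/cvg_mxP xv i|xv].
  by rewrite ReE ImE; apply/cvg_complexP; exact: xv.
apply/cvg_mxP => i j; rewrite ord1; apply/cvg_complexP.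
by rewrite -ReE -ImE.
Qed.

Lemma mderiv_deriv_ge0 (n : nat) (x : R -> 'cV[R[i]]_n) (t : R) v :
  mderiv x t v -> deriv_ge0 x t v.
Proof.
move=> xv; apply/deriv_ge0P => i; have [xr xi] := xv i 0.
by split; apply: cvg_within_filter; apply/is_derive1_quotient.
Qed.

(** At an interior time the constraint [0 <= t + h] holds for all [h] near 0, so the one-sided
    derivative is two-sided. *)
Lemma deriv_gt0_mderiv (n : nat) (x : R -> 'cV[R[i]]_n) (t : R) v :
  0 < t -> deriv_ge0 x t v -> mderiv x t v.
Proof.
move=> t0 /deriv_ge0P xv i j; rewrite ord1; have [xr xi] := xv i.
have W : (0 : R)^' `=>` within [set h : R | 0 <= t + h] (0 : R)^'.
  move=> A WA.
  have H : \forall h \near (0 : R)^', 0 <= t + h.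
    apply: nbhs_dnbhs; apply/nbhs_ballP; exists t => //= h.
    rewrite /ball/= sub0r normrN => /ltr_normlP[]; lra.
  apply: filterS2 (WA : \forall h \near (0 : R)^', 0 <= t + h -> A h) H.
  by move=> h; apply.
by split; apply/is_derive1_quotient;
  [apply: cvg_trans xr|apply: cvg_trans xi]; exact: cvg_app.
Qed.

End MatrixDerivative.

(** * Termwise differentiation of power series of exponential type *)

Section ExponentialSeries.
Variable R : realType.

(** Taylor coefficients of entire functions of exponential type. The class is stable under
    [pseries_diffs], so convergence of a series and of its first two derived series, as termwise
    differentiation requires, comes from a single bound. *)
Definition exp_bounded (c : nat -> R) :=
  exists C K : R, [/\ 0 <= C, 0 <= K & forall k, `|c k| <= C * (K ^+ k / k`!%:R)].

Lemma cvg_exp_bounded (c : nat -> R) (x : R) :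
  exp_bounded c -> cvgn (pseries c x).
Proof.
move=> [C [K [C0 K0 cK]]]; apply: normed_cvg.
have H k : 0 <= C * exp_coeff (K * `|x|) k.
  by rewrite mulr_ge0// exp_coeff_ge0// mulr_ge0.
apply: (series_le_cvg _ H) => [k|k|]; first exact: normr_ge0.
- rewrite /exp_coeff /= normrM normrX exprMn mulrAC mulrA ler_wpM2r ?exprn_ge0//.
- exact: (@is_cvg_seriesZ _ _ C (is_cvg_series_exp_coeff (K * `|x|))).
Qed.

(** The factor [k.+1] cancels against the factorial, and the spare [K] moves into the constant. *)
Lemma exp_bounded_diffs (c : nat -> R) :
  exp_bounded c -> exp_bounded (pseries_diffs c).
Proof.
move=> [C [K [C0 K0 cK]]]; exists (C * K), K; split => //.
  exact: mulr_ge0.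
move=> k; rewrite /pseries_diffs normrM ger0_norm//.
apply: le_trans (ler_wpM2l _ (cK _)) _ => //.
rewrite factS natrM exprS invfM.
rewrite [leLHS](_ : _ = C * K * (K ^+ k / k`!%:R) * (k.+1%:R * k.+1%:R^-1)).
  by rewrite divff ?pnatr_eq0// mulr1.
by ring.
Qed.

Lemma is_derive_exp_bounded (c : nat -> R) (x : R) : exp_bounded c ->
  is_derive x 1 (fun y => limn (pseries c y)) (limn (pseries (pseries_diffs c) x)).
Proof.
move=> cb; apply: (@pseries_snd_diffs _ _ (`|x| + 1)).
- exact: cvg_exp_bounded.
- exact/cvg_exp_bounded/exp_bounded_diffs.
- exact/cvg_exp_bounded/exp_bounded_diffs/exp_bounded_diffs.
- by rewrite [ltRHS]ger0_norm ?addr_ge0// ltrDl.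
Qed.

End ExponentialSeries.

(** * The matrix exponential and its derivative *)

Section MatrixExponential.
Variable R : realType.

Lemma cvg_mulmxr (l m n : nat) (T : Type) (F : set_system T) {FF : Filter F}
    (M : 'M[R[i]]_(m, n)) (f : T -> 'M[R[i]]_(l, m)) (L : 'M[R[i]]_(l, m)) :
  f @ F --> L -> (fun x => f x *m M) @ F --> L *m M.
Proof.
move=> /cvg_mxP fL; apply/cvg_mxP => i j; rewrite mxE.
under eq_fun do rewrite mxE.
apply: cvg_big => [|k _]; first exact: add_continuous.
by apply: cvgM; [exact: fL|exact: cvg_cst].
Qed.

Lemma cvg_mulmxl (l m n : nat) (T : Type) (F : set_system T) {FF : Filter F}
    (M : 'M[R[i]]_(l, m)) (f : T -> 'M[R[i]]_(m, n)) (L : 'M[R[i]]_(m, n)) :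
  f @ F --> L -> (fun x => M *m f x) @ F --> M *m L.
Proof.
move=> /cvg_mxP fL; apply/cvg_mxP => i j; rewrite mxE.
under eq_fun do rewrite mxE.
apply: cvg_big => [|k _]; first exact: add_continuous.
by apply: cvgM; [exact: cvg_cst|exact: fL].
Qed.

Let invC_fact k : (k`!%:R : R[i])^-1 = ((k`!%:R)^-1 : R)%:C.
Proof. by rewrite fmorphV rmorph_nat. Qed.

Variables (n : nat) (B : 'M[R[i]]_n).

Let mx_exprS k : B ^+ k.+1 = B *m B ^+ k.
Proof. exact: exprS. Qed.

Definition expmx_partial (t : R) : nat -> 'M[R[i]]_n :=
  series (fun k : nat => (k`!%:R)^-1 *: (t%:C *: B) ^+ k).

Lemma exprZ_mx (t : R) k : (t%:C *: B) ^+ k = (t ^+ k)%:C *: B ^+ k.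
Proof.
elim: k => [|k IH]; first by rewrite !expr0 scale1r.
by rewrite !exprS IH -!mulmxE -scalemxAl -scalemxAr scalerA -rmorphM.
Qed.

Lemma expmx_partial_Re (t : R) i j :
  (fun N => complex.Re (expmx_partial t N i j)) =
  pseries (fun k => complex.Re ((B ^+ k) i j) / k`!%:R) t.
Proof.
apply/funext => N; rewrite /expmx_partial /pseries /series /= summxE Re_sum.
apply: eq_bigr => k _; rewrite exprZ_mx !mxE.
by rewrite invC_fact !ReZ; ring.
Qed.

Lemma expmx_partial_Im (t : R) i j :
  (fun N => complex.Im (expmx_partial t N i j)) =
  pseries (fun k => complex.Im ((B ^+ k) i j) / k`!%:R) t.
Proof.
apply/funext => N; rewrite /expmx_partial /pseries /series /= summxE Im_sum.
apply: eq_bigr => k _; rewrite exprZ_mx !mxE.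
by rewrite invC_fact !ImZ; ring.
Qed.

Lemma normc_sum (I : Type) (r : seq I) (P : pred I) (F : I -> R[i]) :
  Normc.normc (\sum_(i <- r | P i) F i) <= \sum_(i <- r | P i) Normc.normc (F i).
Proof.
elim/big_ind2: _ => [|x1 x2 y1 y2 h1 h2|//]; first by rewrite Normc.normc0.
by apply: le_trans (le_normcD _ _) _; rewrite lerD.
Qed.

Lemma normc_ge0 (z : R[i]) : 0 <= Normc.normc z.
Proof. by case: z => a b; exact: sqrtr_ge0. Qed.

(** One more factor [B] costs at most a row sum of moduli, which the sum over all entries
    dominates. *)
Lemma normc_expr_mx k i j :
  Normc.normc ((B ^+ k) i j) <= (\sum_i \sum_j Normc.normc (B i j)) ^+ k.
Proof.
set K := \sum_i \sum_j _.
elim: k i j => [|k IH] i j.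
  by rewrite !expr0 mxE; case: (i == j); rewrite ?Normc.normc0 ?Normc.normc1.
rewrite mx_exprS exprS mxE; apply: le_trans (normc_sum _ _ _) _.
have K0 : 0 <= K ^+ k.
  by rewrite exprn_ge0//; do 2 (apply: sumr_ge0 => ? _); exact: normc_ge0.
apply: (@le_trans _ _ ((\sum_j Normc.normc (B i j)) * K ^+ k)).
  rewrite mulr_suml; apply: ler_sum => l _; rewrite Normc.normcM.
  by rewrite ler_wpM2l// normc_ge0.
apply: ler_wpM2r => //; rewrite /K [leRHS](bigD1 i)//= lerDl.
by do 2 (apply: sumr_ge0 => ? _); exact: normc_ge0.
Qed.

Let coef_bounded (p : R[i] -> R) i j : (forall z, `|p z| <= Normc.normc z) ->
  exp_bounded (fun k => p ((B ^+ k) i j) / k`!%:R).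
Proof.
move=> pn; exists 1, (\sum_i \sum_j Normc.normc (B i j)); split => //.
  by do 2 (apply: sumr_ge0 => ? _); exact: normc_ge0.
move=> k; rewrite mul1r normrM normfV normr_nat.
apply: ler_wpM2r; first by rewrite invr_ge0.
exact: le_trans (pn _) (normc_expr_mx _ _ _).
Qed.

Let Rec i j k := complex.Re ((B ^+ k) i j) / k`!%:R.
Let Imc i j k := complex.Im ((B ^+ k) i j) / k`!%:R.

Let Recb i j : exp_bounded (Rec i j).
Proof. exact/coef_bounded/normcRe. Qed.
Let Imcb i j : exp_bounded (Imc i j).
Proof. exact/coef_bounded/normcIm. Qed.

Let expmx_partial_cvg_entries (t : R) : expmx_partial t @ \oo -->
  (\matrix_(i, j) (limn (pseries (Rec i j) t) +i* limn (pseries (Imc i j) t)))%C.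
Proof.
apply/cvg_mxP => i j; apply/cvg_complexP; rewrite !mxE/=.
rewrite expmx_partial_Re expmx_partial_Im.
split; apply: cvg_exp_bounded; [exact: Recb|exact: Imcb].
Qed.

Let expmxE (t : R) : expmx (t%:C *: B) =
  (\matrix_(i, j) (limn (pseries (Rec i j) t) +i* limn (pseries (Imc i j) t)))%C.
Proof. by apply/cvg_lim; [exact: norm_hausdorff|exact: expmx_partial_cvg_entries]. Qed.

Lemma expmx_partial_cvg (t : R) : expmx_partial t @ \oo --> expmx (t%:C *: B).
Proof. by rewrite expmxE; exact: expmx_partial_cvg_entries. Qed.

Lemma expmx0 : expmx (0%:C *: B) = 1%:M.
Proof.
(* The empty partial sum is 0, not the identity, so the sequence is constant only from index 1
   on. *)
have E : (fun N => expmx_partial 0 N.+1) = fun=> 1%:M.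
  apply/funext => N; rewrite /expmx_partial /series /= big_nat_recl//= expr0.
  rewrite fact0 invr1 scale1r big1 ?addr0// => k _.
  by rewrite exprZ_mx expr0n/= scale0r scaler0.
have P1 : expmx_partial 0 @ \oo --> (1%:M : 'M[R[i]]_n).
  by rewrite -cvg_shiftS E; exact: cvg_cst.
by apply: cvg_unique (expmx_partial_cvg (t:=0)) P1; exact: norm_hausdorff.
Qed.

Lemma expmx_comm (M : 'M[R[i]]_n) (t : R) :
  M *m B = B *m M -> M *m expmx (t%:C *: B) = expmx (t%:C *: B) *m M.
Proof.
move=> MB.
have MBk k : M *m B ^+ k = B ^+ k *m M.
  elim: k => [|k IH]; first by rewrite expr0 mulmx1 mul1mx.
  by rewrite mx_exprS mulmxA MB -mulmxA IH mulmxA.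
suff E : (fun N => M *m expmx_partial t N) = fun N => expmx_partial t N *m M.
  have EM : (fun N => expmx_partial t N *m M) @ \oo --> expmx (t%:C *: B) *m M.
    apply: cvg_mulmxr; exact: expmx_partial_cvg.
  have ME : (fun N => expmx_partial t N *m M) @ \oo --> M *m expmx (t%:C *: B).
    by rewrite -E; apply: cvg_mulmxl; exact: expmx_partial_cvg.
  by apply: cvg_unique ME EM; exact: norm_hausdorff.
apply/funext => N; rewrite /expmx_partial /series /= mulmx_suml mulmx_sumr.
apply: eq_bigr => k _; rewrite exprZ_mx -!scalemxAr -!scalemxAl.
by rewrite MBk.
Qed.

(** The derived series of an entry has coefficients given by [B ^+ k.+1] over [k!], which are those
    of the same entry of [B] times the exponential series; the two limits therefore agree. *)
Lemma mderiv_expmx (t : R) :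
  mderiv (fun s => expmx (s%:C *: B)) t (B *m expmx (t%:C *: B)).
Proof.
have /cvg_mxP cB :
    (fun N => B *m expmx_partial t N) @ \oo --> B *m expmx (t%:C *: B).
  apply: cvg_mulmxl; exact: expmx_partial_cvg.
have BP N i j : (B *m expmx_partial t N) i j =
    \sum_(0 <= k < N) (k`!%:R)^-1 * (t ^+ k)%:C * (B ^+ k.+1) i j.
  rewrite /expmx_partial /series /= mulmx_sumr summxE; apply: eq_bigr => k _.
  by rewrite exprZ_mx -!scalemxAr !mxE mx_exprS mxE mulrA.
move=> i j; have /cvg_complexP[cr ci] := cB i j; split.
- under eq_fun do rewrite expmxE mxE/=.
  apply: is_derive_eq; first exact: is_derive_exp_bounded.
  apply/cvg_lim => //; rewrite (_ : pseries _ _ = fun N =>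
    complex.Re ((B *m expmx_partial t N) i j))//.
  apply/funext => N; rewrite BP Re_sum /pseries /series /=.
  apply: eq_bigr => k _; rewrite invC_fact -mulrA !ReZ /pseries_diffs /Rec.
  by rewrite factS natrM invfM mulrCA mulVKf ?pnatr_eq0//; ring.
- under eq_fun do rewrite expmxE mxE/=.
  apply: is_derive_eq; first exact: is_derive_exp_bounded.
  apply/cvg_lim => //; rewrite (_ : pseries _ _ = fun N =>
    complex.Im ((B *m expmx_partial t N) i j))//.
  apply/funext => N; rewrite BP Im_sum /pseries /series /=.
  apply: eq_bigr => k _; rewrite invC_fact -mulrA !ImZ /pseries_diffs /Imc.
  by rewrite factS natrM invfM mulrCA mulVKf ?pnatr_eq0//; ring.
Qed.

End MatrixExponential.

(** * A lower Gronwall inequality *)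

Section Gronwall.
Variable R : realType.

Lemma is_derive1_continuous (f : R -> R) (t l : R) :
  is_derive t 1 f l -> {for t, continuous f}.
Proof. by case=> /derivable1_diffP/differentiable_continuous. Qed.

(** The function [h t = e^{-at} f t] has nonnegative derivative for [t > 0], and right continuity at
    0 extends its monotonicity to the endpoint. Nothing is asked of [f] at negative times, which
    suits solutions on a half-line. *)
Lemma gronwall_ge (f df : R -> R) (a T : R) : 0 <= T ->
  (forall t : R, 0 < t -> is_derive t 1 f (df t)) ->
  (forall t : R, 0 < t -> a * f t <= df t) ->
  f @ 0^'+ --> f 0 ->
  expR (a * T) * f 0 <= f T.
Proof.
move=> T0 fdf adf f0.
pose h (t : R) := expR (- a * t) * f t.
have hd (t : R) : 0 < t ->
    is_derive t 1 h (expR (- a * t) * (df t - a * f t)).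
  move=> t0; have := fdf _ t0 => ?.
  have ? : is_derive t 1 (fun s : R => expR (- a * s)) (- a * expR (- a * t)).
    have ? : is_derive t 1 (fun s : R => - a * s) (- a).
      apply: is_derive_eq (_ : - a *: (1 : R) = - a); last exact: mulr1.
    rewrite mulrC.
    exact: (@is_derive1_comp _ expR (fun s => - a * s) t _ _ (is_derive_expR _) _).
  apply: is_derive_eq.
  by rewrite /GRing.scale/=; ring.
suff : h 0 <= h T.
  rewrite /h mulr0 expR0 mul1r => /(ler_wpM2l (expR_ge0 (a * T))).
  by rewrite mulrA -expRD mulNr subrr expR0 mul1r.
apply: (ger0_derive1_ndecry (a := 0)) => //.
- by move=> x; rewrite in_itv/= andbT => /hd[].
- move=> x; rewrite in_itv/= andbT => x0; rewrite derive1E.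
  by have [_ ->] := hd _ x0; rewrite mulr_ge0 ?expR_ge0// subr_ge0 adf.
- apply/continuous_within_itvcyP; split.
  + move=> x; rewrite in_itv/= andbT => /hd; exact: is_derive1_continuous.
  + apply: cvgM => //; apply: cvg_at_right_filter.
    apply: (@cvg_comp _ _ _ (fun s : R => - a * s) expR); last exact: continuous_expR.
    by apply: cvgM; [exact: cvg_cst|exact: cvg_id].
Qed.

End Gronwall.

(** * Euclidean and operator norms *)

Section EuclideanNorm.
Variable R : realType.

Lemma norm2_ge0 (n : nat) (v : 'cV[R[i]]_n) : 0 <= norm2 v.
Proof. exact: sqrtr_ge0. Qed.

Lemma normc_le_norm2 (n : nat) (v : 'cV[R[i]]_n) i :
  Normc.normc (v i 0) <= norm2 v.
Proof.
rewrite -[leLHS]ger0_norm ?normc_ge0// -sqrtr_sqr ler_wsqrtr//.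
rewrite (bigD1 i)//= lerDl sumr_ge0// => j _; exact: sqr_ge0.
Qed.

Lemma norm2_le_sum (n : nat) (v : 'cV[R[i]]_n) :
  norm2 v <= \sum_i Normc.normc (v i 0).
Proof.
have S0 : 0 <= \sum_i Normc.normc (v i 0).
  by apply: sumr_ge0 => i _; exact: normc_ge0.
rewrite -[leRHS]ger0_norm// -sqrtr_sqr ler_wsqrtr//.
rewrite expr2 mulr_suml; apply: ler_sum => i _; rewrite expr2.
rewrite ler_wpM2l ?normc_ge0// (bigD1 i)//= lerDl sumr_ge0// => j _.
exact: normc_ge0.
Qed.

Lemma norm2_eq0 (n : nat) (v : 'cV[R[i]]_n) : (norm2 v == 0) = (v == 0).
Proof.
apply/eqP/eqP => [v0|->]; last first.
  apply/eqP; rewrite sqrtr_eq0 big1// => i _.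
  by rewrite mxE Normc.normc0 expr0n.
apply/matrixP => i j; rewrite ord1 mxE; apply: Normc.eq0_normc.
by apply/eqP; rewrite eq_le normc_ge0 andbT -v0 normc_le_norm2.
Qed.

Lemma norm2_0 (n : nat) : norm2 (0 : 'cV[R[i]]_n) = 0.
Proof. by apply/eqP; rewrite norm2_eq0. Qed.

Lemma norm2_gt0 (n : nat) (v : 'cV[R[i]]_n) : (0 < norm2 v) = (v != 0).
Proof. by rewrite lt_def norm2_eq0 norm2_ge0 andbT. Qed.

Lemma norm2Z (n : nat) (c : R[i]) (v : 'cV[R[i]]_n) :
  norm2 (c *: v) = Normc.normc c * norm2 v.
Proof.
rewrite /norm2 -[in RHS](ger0_norm (normc_ge0 c)) -sqrtr_sqr -sqrtrM ?sqr_ge0//.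
congr Num.sqrt; rewrite mulr_sumr; apply: eq_bigr => i _.
by rewrite mxE Normc.normcM exprMn.
Qed.

(** A crude majorant of the operator norm, for use where any finite constant will do. In particular
    it bounds the set whose [sup] is [opnorm]; without a bound that [sup] would carry no
    information. *)
Definition entry_sum (m n : nat) (M : 'M[R[i]]_(m, n)) : R :=
  \sum_i \sum_j Normc.normc (M i j).

Lemma entry_sum_ge0 (m n : nat) (M : 'M[R[i]]_(m, n)) : 0 <= entry_sum M.
Proof. by do 2 (apply: sumr_ge0 => ? _); exact: normc_ge0. Qed.

Lemma norm2_mulmx_le (m n : nat) (M : 'M[R[i]]_(m, n)) (v : 'cV[R[i]]_n) :
  norm2 (M *m v) <= entry_sum M * norm2 v.
Proof.
apply: le_trans (norm2_le_sum _) _.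
rewrite mulr_suml; apply: ler_sum => i _; rewrite mxE mulr_suml.
apply: le_trans (normc_sum _ _ _) _; apply: ler_sum => j _.
by rewrite Normc.normcM ler_wpM2l ?normc_ge0// normc_le_norm2.
Qed.

Lemma norm2_mulmx_le_opnorm (m n : nat) (M : 'M[R[i]]_(m, n)) (v : 'cV[R[i]]_n) :
  norm2 (M *m v) <= opnorm M * norm2 v.
Proof.
have [->|v0] := eqVneq v 0.
  by rewrite mulmx0 !norm2_0 mulr0.
rewrite -ler_pdivrMr ?norm2_gt0//; apply: ub_le_sup.
  exists (entry_sum M) => _ [x /= x1 <-]; apply: le_trans (norm2_mulmx_le _ _) _.
  by rewrite -[leRHS]mulr1 ler_wpM2l// entry_sum_ge0.
have Nc : Normc.normc (norm2 v)^-1%:C = (norm2 v)^-1.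
  by rewrite /= expr0n addr0 sqrtr_sqr ger0_norm// invr_ge0 norm2_ge0.
exists ((norm2 v)^-1%:C *: v) => /=.
  by rewrite norm2Z Nc mulVf// norm2_eq0.
by rewrite -scalemxAr norm2Z Nc mulrC.
Qed.

Lemma opnorm_gtP (m n : nat) (M : 'M[R[i]]_(m, n)) (c : R) :
  c < opnorm M -> exists2 x, norm2 x <= 1 & c < norm2 (M *m x).
Proof.
move=> cM.
have [|_ [x /= x1 <-] cx] := @sup_gt _ [set norm2 (M *m x) |
  x in [set x : 'cV[R[i]]_n | norm2 x <= 1]] c _ cM; last by exists x.
by exists (norm2 (M *m 0)), 0 => //=; rewrite norm2_0.
Qed.

Lemma cvg_sqr_norm2 (n : nat) (T : Type) (F : set_system T) {FF : Filter F}
    (X : T -> 'cV[R[i]]_n) (L : 'cV[R[i]]_n) :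
  X @ F --> L -> (fun x => norm2 (X x) ^+ 2) @ F --> norm2 L ^+ 2.
Proof.
move=> /cvg_mxP XL; rewrite sqr_norm2E; under eq_fun do rewrite sqr_norm2E.
apply: cvg_big => [|k _]; first exact: add_continuous.
have /cvg_complexP[Xr Xi] := XL k 0.
by apply: cvgD; under eq_fun do rewrite expr2; apply: cvgM.
Qed.

End EuclideanNorm.

(** * Exponential growth of an orbit *)

Section Growth.
Variables (R : realType) (n : nat) (B : 'M[R[i]]_n).

Lemma mderiv_expmx_orbit (u : 'cV[R[i]]_n) (t : R) :
  mderiv (fun s => expmx (s%:C *: B) *m u) t (B *m (expmx (t%:C *: B) *m u)).
Proof. by rewrite mulmxA; apply: mderivMr; exact: mderiv_expmx. Qed.

(* With [X = exp(tB) u] and [Y = exp(tB) w] one has [X' = z X - Y]; by AM-GM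
   [2 <X, Y> <= a |X|^2 + |Y|^2 / a], so [|X|^2 - S^2 / a^2] grows at least
   like [exp(a t)]. *)
Lemma orbit_unbounded (z : R[i]) (u : 'cV[R[i]]_n) (S : R) :
  let a := complex.Re z in
  let w := z *: u - B *m u in
  0 < a -> 0 <= S -> S < a * norm2 u ->
  (forall t : R, 0 <= t -> norm2 (expmx (t%:C *: B) *m w) <= S) ->
  forall C : R, exists2 t : R, 0 <= t & C < norm2 (expmx (t%:C *: B) *m u).
Proof.
move=> a w a0 S0 Su wS.
pose X (t : R) := expmx (t%:C *: B) *m u; pose Y (t : R) := expmx (t%:C *: B) *m w.
have XY t : B *m X t = z *: X t - Y t.
  rewrite /X /Y /w mulmxBr -scalemxAr subKr !mulmxA expmx_comm//.
have XYi (t : R) i : (B *m X t) i 0 = z * X t i 0 - Y t i 0.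
  by rewrite XY; move: (X t) (Y t) => P P'; rewrite !mxE.
pose N (t : R) := norm2 (X t) ^+ 2.
have Nd (t : R) := is_derive_sqr_norm2 (mderiv_expmx_orbit u t).
have N0 : N 0 = norm2 u ^+ 2 by rewrite /N /X expmx0 mul1mx.
(* The initial excess over the threshold, positive because [S < a * norm2 u]. *)
pose dl := N 0 - (S / a) ^+ 2.
have grow (t : R) : 0 <= t -> expR (a * t) * dl <= N t - (S / a) ^+ 2.
  move=> t0.
  apply: (@gronwall_ge _ (fun s => N s - (S / a) ^+ 2)
    (fun s => \sum_i 2 * (complex.Re (X s i 0) * complex.Re ((B *m X s) i 0) +
                 complex.Im (X s i 0) * complex.Im ((B *m X s) i 0)))) => //.
  - move=> s _; have := Nd s => ?; apply: is_derive_eq.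
    by rewrite subr0.
  - move=> s s0.
    have : norm2 (Y s) ^+ 2 / a <= S ^+ 2 / a.
      rewrite ler_pdivrMr// divfK ?gt_eqF// lerXn2r ?nnegrE ?norm2_ge0//.
      by rewrite wS// ltW.
    rewrite /N !sqr_norm2E => YS.
    apply: (@le_trans _ _ (a * (\sum_i (complex.Re (X s i 0) ^+ 2 + complex.Im (X s i 0) ^+ 2))
      - (\sum_i (complex.Re (Y s i 0) ^+ 2 + complex.Im (Y s i 0) ^+ 2)) / a)).
      rewrite mulrBr lerB//.
      suff -> : a * (S / a) ^+ 2 = S ^+ 2 / a by [].
      by field; rewrite gt_eqF.
    rewrite mulr_sumr mulr_suml -sumrB; apply: ler_sum => i _.
    rewrite XYi ReD ImD ReN ImN ReM ImM.
    set p := complex.Re (X s i 0); set q := complex.Im (X s i 0).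
    set p' := complex.Re (Y s i 0); set q' := complex.Im (Y s i 0).
    rewrite -/a -subr_ge0.
    (* The imaginary part of [z] cancels, and the slack is a complete square: the entry of
       [a X - Y], squared in modulus, over [a]. *)
    rewrite [X in 0 <= X](_ : _ = ((a * p - p') ^+ 2 + (a * q - q') ^+ 2) / a).
      by rewrite divr_ge0 ?(ltW a0)// addr_ge0// sqr_ge0.
    by field; rewrite gt_eqF.
  - apply: cvgB; last exact: cvg_cst.
    apply: cvg_at_right_filter.
    exact: is_derive1_continuous (Nd 0).
move=> C.
have dl0 : 0 < dl.
  rewrite /dl subr_gt0 N0 ltr_pXn2r ?nnegrE ?norm2_ge0 ?divr_ge0 ?(ltW a0)//.
  by rewrite ltr_pdivrMr// mulrC.
(* A positive majorant of [C], so that squares can be compared. By [e^{at} >= 1 + a t], the time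
   chosen below gives [e^{at} dl >= dl + C'^2]. *)
pose C' := `|C| + 1.
have C'0 : 0 < C' by rewrite ltr_wpDl.
have t0 : 0 <= C' ^+ 2 / (a * dl) by rewrite divr_ge0 ?sqr_ge0 ?mulr_ge0 ?ltW.
exists (C' ^+ 2 / (a * dl)) => //.
have : C' ^+ 2 < N (C' ^+ 2 / (a * dl)).
  have e1 := expR_ge1Dx (a * (C' ^+ 2 / (a * dl))).
  have E : a * (C' ^+ 2 / (a * dl)) * dl = C' ^+ 2 by field; rewrite !gt_eqF.
  have := ler_wpM2r (ltW dl0) e1; rewrite mulrDl mul1r E => h1.
  apply: lt_le_trans (_ : dl + C' ^+ 2 <= _); first by rewrite ltrDr.
  apply: le_trans h1 _; apply: le_trans (grow _ t0) _.
  by rewrite gerBl sqr_ge0.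
rewrite ltr_pXn2r ?nnegrE ?norm2_ge0 ?ltW// => /(lt_trans _); apply.
by rewrite /C' (le_lt_trans (ler_norm C))// ltrDl.
Qed.

End Growth.

(** * Approximate eigenpairs and the orbits they produce *)

Section PseudoModes.
Variables (R : realType) (n : nat) (B : 'M[R[i]]_n).

(** The bound on the residual is weak so that these pairs form a closed set; true eigenpairs are
    included with residual 0. *)
Definition pseudo_mode (eps : R) (z : R[i]) (u : 'cV[R[i]]_n) : Prop :=
  norm2 u = 1 /\ norm2 (z *: u - B *m u) <= eps.

Definition orbit_sup (y : 'cV[R[i]]_n) : \bar R :=
  ereal_sup [set (norm2 (expmx (t%:C *: B) *m y) / norm2 y)%:E
            | t in [set t : R | 0 <= t]].

Lemma singular_kernel (M : 'M[R[i]]_n) :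
  M \notin unitmx -> exists2 v : 'cV[R[i]]_n, v != 0 & M *m v = 0.
Proof.
rewrite -unitmx_tr unitmxE unitfE negbK => /eqP/eqP/det0P[v v0 vM].
exists v^T; first by rewrite -(inj_eq trmx_inj) trmxK trmx0.
by apply: trmx_inj; rewrite trmx_mul trmxK trmx0.
Qed.

Lemma shiftE (z : R[i]) (u : 'cV[R[i]]_n) : (z%:M - B) *m u = z *: u - B *m u.
Proof. by rewrite mulmxBl mul_scalar_mx. Qed.

Lemma norm2_mode (v : 'cV[R[i]]_n) : v != 0 -> norm2 ((norm2 v)^-1%:C *: v) = 1.
Proof.
move=> v0; rewrite norm2Z /= expr0n addr0 sqrtr_sqr ger0_norm ?invr_ge0 ?norm2_ge0//.
by rewrite mulVf// norm2_eq0.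
Qed.

(** Take [x] in the unit ball with [v = (z - B)^-1 x] longer than [1 / eps]; after normalising [v]
    the residual is [norm2 x / norm2 v], below [eps]. In the singular case a kernel vector has
    residual 0. *)
Lemma pseudospectrum_mode (eps : R) (z : R[i]) : 0 < eps ->
  ((eps^-1)%:E < opnorm_inv (z%:M - B))%E -> exists u, pseudo_mode eps z u.
Proof.
move=> eps0; rewrite /opnorm_inv; case: ifPn => [Mu|/singular_kernel[v v0 vM] _].
  rewrite lte_fin => /opnorm_gtP[x x1 xM].
  set v := invmx _ *m x in xM.
  have v_gt0 : 0 < norm2 v by rewrite (lt_trans _ xM)// invr_gt0.
  exists ((norm2 v)^-1%:C *: v); split; first by rewrite norm2_mode// -norm2_gt0.
  rewrite -shiftE -scalemxAr /v mulKVmx// -/v norm2Z /= expr0n addr0 sqrtr_sqr.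
  rewrite ger0_norm ?invr_ge0 ?norm2_ge0// mulrC ler_pdivrMr//.
  apply: le_trans x1 _.
  by rewrite -ler_pdivrMl// mulr1 ltW.
exists ((norm2 v)^-1%:C *: v); split; first exact: norm2_mode.
rewrite -shiftE -scalemxAr vM scaler0 ltW//.
by rewrite norm2_0.
Qed.

Lemma orbit_sup_ge (y : 'cV[R[i]]_n) (t : R) : 0 <= t ->
  ((norm2 (expmx (t%:C *: B) *m y) / norm2 y)%:E <= orbit_sup y)%E.
Proof. by move=> t0; apply: ereal_sup_ubound; exists t. Qed.

Lemma orbit_sup_ge1 (y : 'cV[R[i]]_n) : y != 0 -> (1%:E <= orbit_sup y)%E.
Proof.
move=> y0; have := orbit_sup_ge y (lexx 0).
by rewrite expmx0 mul1mx divff// norm2_eq0.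
Qed.

Lemma mode_orbit (eps : R) (z : R[i]) (u : 'cV[R[i]]_n) :
  0 < eps -> 0 < complex.Re z -> pseudo_mode eps z u ->
  exists2 y, y != 0 & ((complex.Re z / eps)%:E <= orbit_sup y)%E.
Proof.
move=> eps0 z0 [u1 weps].
have [Mu|/singular_kernel[v v0]] := boolP (z%:M - B \in unitmx); last first.
  rewrite shiftE => vM; exists v => //.
  (* The residual of an eigenvector vanishes, so [S = 0] is admissible and the orbit exceeds any
     prescribed bound. *)
  have [||t t0 Ct] := @orbit_unbounded _ _ B z v 0 z0 (lexx 0) _ _
    (complex.Re z / eps * norm2 v).
  - by rewrite mulr_gt0// norm2_gt0.
  - by move=> t _; rewrite vM mulmx0 norm2_0.
  - apply: le_trans (orbit_sup_ge v t0).
    by rewrite lee_fin ler_pdivlMr ?norm2_gt0// ltW.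
set w := z *: u - B *m u in weps.
have u0 : u != 0 by rewrite -norm2_eq0 u1 oner_eq0.
have w0 : w != 0.
  apply: contra_neq u0 => w0.
  by rewrite -[u](mulKmx Mu) shiftE -/w w0 mulmx0.
exists w => //; rewrite leNgt; apply/negP => sup_lt.
have := orbit_sup_ge1 w0; have := orbit_sup_ge w.
(* Lying below a real number and above 1, the supremum is a real [s]. *)
move: sup_lt; case: (orbit_sup w) => // s.
rewrite lte_fin lee_fin => s_lt ws s1.
have s0 : 0 <= s by exact: le_trans s1.
have wS (t : R) : 0 <= t -> norm2 (expmx (t%:C *: B) *m w) <= s * norm2 w.
  by move=> /ws; rewrite lee_fin ler_pdivrMr ?norm2_gt0.
(* Here [S = s |w|] is less than [a = a |u|], because [s < a / eps] and [|w| <= eps]. The bound to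
   be exceeded is the one that the resolvent imposes on the orbit of [u]. *)
have [||t t0] := @orbit_unbounded _ _ B z u (s * norm2 w) z0 _ _ wS
  (entry_sum (invmx (z%:M - B)) * (s * norm2 w)).
- by rewrite mulr_ge0// norm2_ge0.
- rewrite u1 mulr1; apply: le_lt_trans (_ : s * eps < _).
    by rewrite ler_wpM2l.
  by rewrite -ltr_pdivlMr.
have -> : expmx (t%:C *: B) *m u =
          invmx (z%:M - B) *m (expmx (t%:C *: B) *m w).
  rewrite /w -shiftE [in RHS]mulmxA -expmx_comm.
    by rewrite -mulmxA mulKmx.
  by rewrite mulmxBl mulmxBr scalar_mxC.
move/lt_le_trans => /(_ _ (norm2_mulmx_le _ _)).
rewrite ltNge => /negP; apply.
by rewrite ler_wpM2l ?entry_sum_ge0// wS.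
Qed.

Lemma continuous_complex (T : topologicalType) (f : T -> R[i]) :
  continuous (fun p => complex.Re (f p)) ->
  continuous (fun p => complex.Im (f p)) -> continuous f.
Proof.
by move=> fr fi p; apply/cvg_complexP; split; [exact: fr|exact: fi].
Qed.

Lemma continuous_sqr_norm2 (T : topologicalType) (V : T -> 'cV[R[i]]_n) :
  (forall i, continuous (fun p => V p i 0)) -> continuous (fun p => norm2 (V p) ^+ 2).
Proof.
move=> Vc p; apply: cvg_sqr_norm2.
by apply/cvg_mxP => i j; rewrite ord1; exact: Vc.
Qed.

Lemma continuous_residual (T : topologicalType) (c : T -> R[i])
    (V : T -> 'cV[R[i]]_n) (i : 'I_n) :
  continuous c -> (forall i, continuous (fun p => V p i 0)) ->
  continuous (fun p => (c p *: V p - B *m V p) i 0).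
Proof.
move=> cc Vc; under eq_fun do rewrite !mxE.
move=> p; apply: cvgB; first by apply: cvgM; [exact: cc|exact: Vc].
apply: cvg_big => [|k _]; first exact: add_continuous.
by apply: cvgM; [exact: cvg_cst|exact: Vc].
Qed.

(** A pair [(z, u)] is stored as [n.+1] real parts followed by [n.+1] imaginary parts, with [z] at
    index 0, so that compactness of boxes and the extreme value theorem for real row vectors
    apply. *)
Let enc := 'rV[R]_(n.+1 + n.+1).

Let coord (j : 'I_n.+1) (p : enc) : R[i] :=
  (p 0 (lshift n.+1 j) +i* p 0 (rshift n.+1 j))%C.
Let vect (p : enc) : 'cV[R[i]]_n := \col_j coord (lift ord0 j) p.
Let residual (p : enc) := coord ord0 p *: vect p - B *m vect p.

Let coord_cont j : continuous (coord j).
Proof. by apply: continuous_complex; exact: coord_continuous. Qed.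

Let vect_cont i : continuous (fun p => vect p i 0).
Proof. by under eq_fun do rewrite mxE; exact: coord_cont. Qed.

Let residual_cont i : continuous (fun p => residual p i 0).
Proof.
by apply: (@continuous_residual _ (coord ord0) vect);
  [exact: coord_cont|exact: vect_cont].
Qed.

(** Since [|u| = 1], [|z|] is the norm of [z u], which is the residual plus [B u]. The factor [n]
    comes from estimating entry by entry. *)
Lemma pseudo_mode_bound (eps : R) z u :
  pseudo_mode eps z u -> Normc.normc z <= n%:R * (eps + entry_sum B).
Proof.
move=> [u1 weps]; have -> : Normc.normc z = norm2 (z *: u).
  by rewrite norm2Z u1 mulr1.
apply: le_trans (norm2_le_sum _) _.
rewrite -[n in n%:R]card_ord mulr_natl -sumr_const; apply: ler_sum => i _.
have -> : (z *: u) i 0 = (z *: u - B *m u) i 0 + (B *m u) i 0.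
  by move: (z *: u) (B *m u) => x y; rewrite !mxE subrK.
apply: le_trans (le_normcD _ _) _; apply: lerD.
  exact: le_trans (normc_le_norm2 _ _) weps.
apply: le_trans (normc_le_norm2 _ _) _; apply: le_trans (norm2_mulmx_le _ _) _.
by rewrite u1 mulr1.
Qed.

Lemma rightmost_mode (eps : R) z0 u0 : pseudo_mode eps z0 u0 ->
  exists z u, pseudo_mode eps z u /\
    forall z' u', pseudo_mode eps z' u' -> complex.Re z' <= complex.Re z.
Proof.
move=> zu0; have eps0 : 0 <= eps by apply: le_trans zu0.2; exact: norm2_ge0.
(* Squared norms are polynomial in the real coordinates, which makes both conditions visibly
   closed. *)
pose K := [set p : enc | norm2 (vect p) ^+ 2 = 1] `&`
          [set p : enc | norm2 (residual p) ^+ 2 <= eps ^+ 2].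
have KP p : K p <-> pseudo_mode eps (coord ord0 p) (vect p).
  split=> [[/= v1 re]|[v1 re]].
    split; first by apply/eqP; rewrite -(@eqrXn2 _ 2) ?norm2_ge0 ?expr1n ?v1.
    by rewrite -(@ler_pXn2r _ 2) ?nnegrE ?norm2_ge0.
  by split=> /=; [rewrite v1 expr1n|rewrite lerXn2r ?nnegrE ?norm2_ge0].
pose mk (z : R[i]) (u : 'cV[R[i]]_n) : enc :=
  let c (j : 'I_n.+1) := if unlift ord0 j is Some k then u k 0 else z in
  row_mx (\row_j complex.Re (c j)) (\row_j complex.Im (c j)).
have mkz z u : coord ord0 (mk z u) = z.
  by rewrite /coord /mk row_mxEl row_mxEr !mxE unlift_none; case: z.
have mku z u : vect (mk z u) = u.
  apply/matrixP => j k; rewrite ord1 mxE /coord /mk row_mxEl row_mxEr !mxE liftK.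
  by case: (u j 0).
have Kmk z u : pseudo_mode eps z u -> K (mk z u) by rewrite KP mkz mku.
have Kclosed : closed K.
  apply: closedI.
    apply: (@closed_comp _ _ (fun p => norm2 (vect p) ^+ 2) [set x | x = 1]).
      by move=> p _; exact: (continuous_sqr_norm2 vect_cont).
    exact: closed_eq.
  apply: (@closed_comp _ _ (fun p => norm2 (residual p) ^+ 2) [set x | x <= eps ^+ 2]).
    by move=> p _; exact: (continuous_sqr_norm2 residual_cont).
  exact: closed_le.
(* The added 1 lets the same box hold the entries of the unit vector [u]. *)
pose M := n%:R * (eps + entry_sum B) + 1.
have M1 : 1 <= M by rewrite lerDr mulr_ge0// addr_ge0// entry_sum_ge0.
have cb p j : K p -> Normc.normc (coord j p) <= M.
  move=> /KP m; case: (unliftP ord0 j) => [k|] ->.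
    have -> : coord (lift ord0 k) p = vect p k 0 by rewrite mxE.
    by apply: le_trans (normc_le_norm2 _ _) _; rewrite m.1.
  by apply: le_trans (pseudo_mode_bound m) _; rewrite lerDl.
have Kcompact : compact K.
  have box : compact [set v : enc | forall i, v ord0 i \in `[- M, M]].
    apply: (@rV_compact _ _ (fun=> `[- M, M]%classic)) => _.
    exact: segment_compact.
  apply: subclosed_compact Kclosed box _ => p Kp i /=.
  rewrite in_itv/= -ler_norml.
  case: (split_ordP i) => j ->; apply: le_trans (cb p j Kp).
    by rewrite (le_trans _ (normcRe _)).
  by rewrite (le_trans _ (normcIm _)).
have Kne : K !=set0 by exists (mk z0 u0); exact: Kmk.
have [c cK cmax] := @EVT_max_rV _ _ (fun p : enc => p 0 (lshift n.+1 ord0)) K Kne Kcompact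
  (continuous_subspaceT (@coord_continuous _ _ _ _ _)).
exists (coord ord0 c), (vect c); split.
  by apply/KP; move: cK; rewrite inE.
move=> z' u' m'; have := cmax (mk z' u') (mem_set (Kmk _ _ m')).
by rewrite /= {1}/mk row_mxEl !mxE unlift_none.
Qed.

Lemma abscissa_orbit (G : 'M[R[i]]_n) (mu : R[i]) (eps : R) : (0 < n)%N ->
  B = invmx G + mu%:M -> 0 < eps ->
  exists2 y, y != 0 & (pencil_abscissa G mu eps * (eps^-1)%:E <= orbit_sup y)%E.
Proof.
move=> n0 BE eps0.
have [[z [zP z0]]|nz] := pselect (exists z, pencil_pseudospectrum G mu eps z /\
    0 < complex.Re z).
  have [u um] : exists u, pseudo_mode eps z u.
    by apply: (pseudospectrum_mode eps0); rewrite BE; exact: zP.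
  have [z' [u' [um' zmax]]] := rightmost_mode um.
  have [y y0 ysup] : exists2 y, y != 0 & ((complex.Re z' / eps)%:E <= orbit_sup y)%E.
    (* The rightmost [z'] inherits a positive real part from [z]. *)
    by apply: (mode_orbit eps0 _ um'); apply: lt_le_trans z0 (zmax _ _ um).
  exists y => //; apply: le_trans ysup.
  rewrite EFinM; apply: lee_wpmul2r; first by rewrite lee_fin invr_ge0 ltW.
  apply: ge_ereal_sup => _ [x xP <-]; rewrite lee_fin.
  have [v vm] : exists v, pseudo_mode eps x v.
    by apply: (pseudospectrum_mode eps0); rewrite BE; exact: xP.
  exact: zmax vm.
(* The abscissa is now at most 0, so any nonzero vector works through its ratio 1 at [t = 0];
   [0 < n] provides one. *)
have y0 : const_mx 1 != 0 :> 'cV[R[i]]_n.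
  apply/eqP => /matrixP/(_ (Ordinal n0) 0); rewrite !mxE => /eqP.
  by rewrite oner_eq0.
exists (const_mx 1) => //; apply: le_trans (orbit_sup_ge1 y0).
apply: (@le_trans _ _ 0%E); last by rewrite lee_fin.
apply: mule_le0_ge0; last by rewrite lee_fin invr_ge0 ltW.
apply: ge_ereal_sup => _ [x xP <-]; rewrite lee_fin leNgt; apply/negP => x0.
by apply: nz; exists x.
Qed.

End PseudoModes.

(** * Uniqueness for the nilpotent and the invertible block *)

Section DifferentialAlgebraic.
Variable R : realType.

Lemma deriv_ge0_cvg_right (n : nat) (x : R -> 'cV[R[i]]_n) v :
  deriv_ge0 x 0 v -> x @ 0^'+ --> x 0.
Proof.
move=> /deriv_ge0P xv; apply/cvg_mxP => i j; rewrite ord1.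
have E : [set h : R | 0 <= 0 + h] = [set h | 0 <= h].
  by apply/seteqP; split => h /=; rewrite add0r.
have [xr xi] := xv i; rewrite E in xr xi.
by apply/cvg_complexP; split;
  [exact: (quotient_cvg_right xr)|exact: (quotient_cvg_right xi)].
Qed.

Lemma mderiv_eq0 (m n : nat) (X : R -> 'M[R[i]]_(m, n)) (t : R) V :
  0 < t -> (forall s, 0 < s -> X s = 0) -> mderiv X t V -> V = 0.
Proof.
move=> t0 X0 XV; apply/matrixP => i j; rewrite [RHS]mxE.
have D0 (f : R -> R) l : (forall s, 0 < s -> f s = 0) -> is_derive t 1 f l -> l = 0.
  move=> f0 [_ <-]; rewrite (@near_eq_derive _ _ _ f (cst 0)) ?derive_cst//.
  by apply: filterS (lt_nbhsr t0) => s /f0.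
have [Vr Vi] := XV i j; apply/eqP; rewrite eq_complex.
by apply/andP; split; apply/eqP; [apply: D0 Vr|apply: D0 Vi] => s /X0 ->; rewrite mxE.
Qed.

(** If [N^(m+1) q] vanishes for all positive times, so does its derivative [N^(m+1) q']; then
    [N^m q = N^(m+1) (q' - mu q)] vanishes too. Descend from [N^k = 0] to [m = 0]. *)
Lemma nilpotent_dae_eq0 (d : nat) (N : 'M[R[i]]_d) (mu : R[i]) (k : nat)
    (q q' : R -> 'cV[R[i]]_d) :
  N ^+ k = 0 ->
  (forall t, 0 < t -> mderiv q t (q' t)) ->
  (forall t, 0 < t -> N *m (q' t - mu *: q t) = q t) ->
  forall t, 0 < t -> q t = 0.
Proof.
move=> Nk qd Nq.
suff H j : (j <= k)%N -> forall t, 0 < t -> N ^+ (k - j) *m q t = 0.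
  by move=> t t0; have := H k (leqnn k) t t0; rewrite subnn expr0 mul1mx.
elim: j => [|j IH] jk t t0; first by rewrite subn0 Nk mul0mx.
have kj : (k - j = (k - j.+1).+1)%N by rewrite -subSn.
have {}IH := IH (ltnW jk).
have Nq' : N ^+ (k - j) *m q' t = 0.
  by apply: (mderiv_eq0 t0 IH); apply: mderivMl; exact: qd.
rewrite -(Nq t t0) mulmxA.
have -> : N ^+ (k - j.+1) *m N = N ^+ (k - j) by rewrite kj; exact/esym/exprSr.
by rewrite mulmxBr Nq' -scalemxAr IH// scaler0 subr0.
Qed.

(** An energy estimate: [2 <p, B p> <= |p|^2 + |B p|^2], which explains the constant [C]. The lower
    Gronwall bound is applied to the negative of the squared norm, which starts at 0. *)
Lemma linear_ode_eq0 (m : nat) (B : 'M[R[i]]_m) (p : R -> 'cV[R[i]]_m) :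
  (forall t, 0 < t -> mderiv p t (B *m p t)) ->
  p @ 0^'+ --> p 0 -> p 0 = 0 -> forall t, 0 <= t -> p t = 0.
Proof.
move=> pd pc p0 t t0.
pose C := 1 + entry_sum B ^+ 2.
have := @gronwall_ge _ (fun s => - norm2 (p s) ^+ 2)
  (fun s => - \sum_i 2 * (complex.Re (p s i 0) * complex.Re ((B *m p s) i 0) +
                 complex.Im (p s i 0) * complex.Im ((B *m p s) i 0))) C t t0.
rewrite p0 norm2_0 expr0n /= oppr0 mulr0 oppr_ge0 => H.
suff : norm2 (p t) ^+ 2 <= 0.
  by rewrite le_eqVlt ltNge sqr_ge0 orbF sqrf_eq0 norm2_eq0 => /eqP.
apply: H.
- by move=> s s0; have ? := is_derive_sqr_norm2 (pd s s0); apply: is_deriveN.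
- move=> s s0; rewrite mulrN lerN2.
  apply: (@le_trans _ _ (norm2 (p s) ^+ 2 + norm2 (B *m p s) ^+ 2)).
    rewrite !sqr_norm2E -big_split/=; apply: ler_sum => i _.
    move: (complex.Re (p s i 0)) (complex.Im (p s i 0)).
    move: (complex.Re _) (complex.Im _) => b b' a a'.
    have := sqr_ge0 (a - b); have := sqr_ge0 (a' - b'); nra.
  rewrite /C mulrDl mul1r lerD2l -exprMn lerXn2r ?nnegrE ?norm2_ge0//.
    by rewrite mulr_ge0 ?entry_sum_ge0 ?norm2_ge0.
  exact: norm2_mulmx_le.
- rewrite -[X in _ --> X]oppr0; apply: cvgN.
  have := cvg_sqr_norm2 pc; rewrite p0 norm2_0 expr0n.
  by apply.
Qed.

End DifferentialAlgebraic.

(** [n - d + d] equals [n] only propositionally, so the square case has to be transported along an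
    equation of dimensions. *)
Lemma mulmx1C_eq (F : comUnitRingType) (n p : nat) (V : 'M[F]_(n, p))
    (W : 'M[F]_(p, n)) : p = n -> V *m W = 1%:M -> W *m V = 1%:M.
Proof. by move=> e; case: n / e V W => V W; exact: mulmx1C. Qed.

(** * Block identities of the Schur splitting *)

Section SchurSplitting.
Variables (R : realType) (n d : nat).
Local Open Scope sesquilinear_scope.
Variables (M : 'M[R[i]]_n) (Q : 'M[R[i]]_(n, n - d)) (Qt : 'M[R[i]]_(n, d)).
Variables (G : 'M[R[i]]_(n - d)) (D : 'M[R[i]]_(n - d, d)) (N : 'M[R[i]]_d).
Hypotheses (dn : (d <= n)%N) (schurM : schur_splitting M Q Qt G D N).

Let U := row_mx Q Qt.

Let UUt : U *m U^t* = 1%:M.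
Proof. by have [_ [/unitarymxP]] := schurM. Qed.

Let ME : M = U *m block_mx G D 0 N *m U^t*.
Proof. by have [_ []] := schurM. Qed.

Let UtU : U^t* *m U = 1%:M.
Proof. by apply: mulmx1C_eq UUt; exact: subnK. Qed.

Let UtE : U^t* = col_mx (Q^t*) (Qt^t*).
Proof. by rewrite tr_row_mx map_col_mx. Qed.

Lemma schur_decomposition : Q *m Q^t* + Qt *m Qt^t* = 1%:M.
Proof. by rewrite -mul_row_col -UtE. Qed.

Lemma schur_orthonormal : Q^t* *m Q = 1%:M.
Proof.
have := UtU; rewrite UtE mul_col_row scalar_mx_block => /eq_block_mx[].
by [].
Qed.

Lemma schur_range : M *m Q = Q *m G.
Proof.
have : M *m U = U *m block_mx G D 0 N by rewrite ME -!mulmxA UtU mulmx1.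
by rewrite mul_mx_row mul_row_block mulmx0 addr0 => /eq_row_mx[].
Qed.

(** The block rows of [U^* M = T U^*]. The second involves the [Qt] component alone, so the equation
    can be solved from the bottom up. *)
Lemma schur_corange :
  Q^t* *m M = G *m Q^t* + D *m Qt^t* /\ Qt^t* *m M = N *m Qt^t*.
Proof.
have : U^t* *m M = block_mx G D 0 N *m U^t* by rewrite ME !mulmxA UtU mul1mx.
by rewrite UtE mul_col_mx mul_block_col mul0mx add0r => /eq_col_mx.
Qed.

Lemma schur_unit : G \in unitmx.
Proof.
have [_ _ _ _] := schurM; rewrite /eigenvalue /eigenspace negbK.
by rewrite raddf0 subr0 kermx_eq0 row_free_unit.
Qed.

Lemma norm2_schur (y : 'cV[R[i]]_(n - d)) : norm2 (Q *m y) = norm2 y.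
Proof.
have sqr_norm2_mx k (v : 'cV[R[i]]_k) : (norm2 v ^+ 2)%:C = (v^t* *m v) 0 0.
  rewrite sqr_norm2E rmorph_sum mxE; apply: eq_bigr => i _.
  rewrite !mxE; case: (v i 0) => a b; apply/eqP.
  by rewrite eq_complex /=; apply/andP; split; apply/eqP; ring.
apply/eqP; rewrite -(@eqrXn2 _ 2) ?norm2_ge0//; apply/eqP/complexI.
rewrite !sqr_norm2_mx trmx_mul map_mxM mulmxA -[_ *m Q]mulmxA.
by rewrite schur_orthonormal mulmx1.
Qed.

End SchurSplitting.

(** * Existence and uniqueness of solutions of the pencil equation *)

Section PencilSolutions.
Variables (R : realType) (n d : nat) (A E : 'M[R[i]]_n) (mu : R[i]).
Variables (Q : 'M[R[i]]_(n, n - d)) (Qt : 'M[R[i]]_(n, d)).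
Variables (G : 'M[R[i]]_(n - d)) (D : 'M[R[i]]_(n - d, d)) (N : 'M[R[i]]_d).
Hypotheses (mu_unit : A - mu *: E \in unitmx) (dn : (d <= n)%N).
Hypothesis schurE : schur_splitting (shift_invert A E mu) Q Qt G D N.
Local Open Scope sesquilinear_scope.

Let B := invmx G + mu%:M.
Let M := shift_invert A E mu.

Let shiftM : (A - mu *: E) *m M = E.
Proof. by rewrite /M /shift_invert mulKVmx. Qed.

(** Invariance of the range of [Q] gives [E Q = (A - mu E) Q G]; multiply by [G^-1] on the right and
    add [mu E Q]. This is what turns orbits of [B] into solutions. *)
Lemma pencil_range : E *m Q *m B = A *m Q.
Proof.
have MQ : M *m Q = Q *m G := schur_range dn schurE.
have EQ : E *m Q = (A - mu *: E) *m Q *m G.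
  by rewrite -mulmxA -MQ mulmxA shiftM.
rewrite /B mulmxDr mul_mx_scalar {1}EQ mulmxK ?(schur_unit schurE)//.
by rewrite mulmxBl -scalemxAl subrK.
Qed.

Lemma dae_solution_orbit (y : 'cV[R[i]]_(n - d)) :
  dae_solution A E (fun t : R => Q *m (expmx (t%:C *: B) *m y)).
Proof.
move=> t _; exists (Q *m (B *m (expmx (t%:C *: B) *m y))).
  by apply/mderiv_deriv_ge0/mderivMl; exact: mderiv_expmx_orbit.
by rewrite [LHS]mulmxA [LHS]mulmxA pencil_range -mulmxA.
Qed.

(** Subtracting [mu E x] from both sides leaves [E (v - mu x) = (A - mu E) x], where the right-hand
    factor can be inverted. *)
Lemma shift_invert_dae (x v : 'cV[R[i]]_n) :
  E *m v = A *m x -> M *m (v - mu *: x) = x.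
Proof.
move=> Ev; rewrite /M /shift_invert -mulmxA mulmxBr Ev -scalemxAr scalemxAl.
by rewrite -mulmxBl mulKmx.
Qed.

Lemma dae_solution_unique (x x' : R -> 'cV[R[i]]_n) :
  dae_solution A E x -> dae_solution A E x' -> x' 0 = x 0 ->
  forall t, 0 <= t -> x' t = x t.
Proof.
move=> xs xs' x0.
pose dl t := x' t - x t.
have dlP t : 0 < t -> exists2 v, mderiv dl t v & M *m (v - mu *: dl t) = dl t.
  move=> t0; have [v xv Ev] := xs t (ltW t0); have [v' xv' Ev'] := xs' t (ltW t0).
  exists (v' - v); first by apply: mderivB; exact: deriv_gt0_mderiv.
  by apply: shift_invert_dae; rewrite !mulmxBr Ev Ev'.
have [v vP] : exists v : R -> 'cV[R[i]]_n, forall t, 0 < t ->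
    mderiv dl t (v t) /\ M *m (v t - mu *: dl t) = dl t.
  have /choice[v vP] : forall t : R, exists v, 0 < t ->
      mderiv dl t v /\ M *m (v - mu *: dl t) = dl t.
    move=> t; have [t0|_] := ltP 0 t; last by exists 0.
    by have [v ? ?] := dlP t t0; exists v.
  by exists v.
have [QsM QtsM] := schur_corange dn schurE.
pose q t := Qt^t* *m dl t.
have qd t : 0 < t -> mderiv q t (Qt^t* *m v t).
  by move=> /vP[? _]; exact: mderivMl.
have q0 t : 0 < t -> q t = 0.
  have [_ _ _ [k Nk] _] := schurE.
  apply: (nilpotent_dae_eq0 Nk qd (mu := mu)) => s s0.
  rewrite scalemxAr -mulmxBr mulmxA -QtsM -mulmxA.
  by have [_ ->] := vP s s0.
pose p t := Q^t* *m dl t.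
have p0 t : 0 <= t -> p t = 0.
  apply: (@linear_ode_eq0 _ _ B) => [s s0||].
  - have -> : B *m p s = Q^t* *m v s; last by apply: mderivMl; have [] := vP s s0.
    have [vd vE] := vP s s0.
    have qv0 : Qt^t* *m v s = 0 by exact: mderiv_eq0 s0 q0 (qd s s0).
    (* With the [Qt] component and its derivative gone, the coupling block [D] drops out, and
       inverting [G] leaves [p' = B p]. *)
    have pE : p s = G *m (Q^t* *m v s - mu *: p s).
      rewrite {1}/p -vE mulmxA QsM mulmxDl -!mulmxA [Qt^t* *m _]mulmxBr qv0.
      rewrite -scalemxAr -/(q s) (q0 s s0) scaler0 subr0 mulmx0 addr0.
      by rewrite mulmxBr -scalemxAr.
    rewrite /B mulmxDl mul_scalar_mx {1}pE mulKmx ?(schur_unit schurE)//.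
    by rewrite subrK.
  - have [v1 /deriv_ge0_cvg_right xc _] := xs 0 (lexx 0).
    have [v1' /deriv_ge0_cvg_right xc' _] := xs' 0 (lexx 0).
    have dlc : dl @ 0^'+ --> dl 0 by apply: cvgB; [exact: xc'|exact: xc].
    exact: (cvg_mulmxl dlc).
  - by rewrite /p /dl x0 subrr mulmx0.
(* The initial time is treated apart, as [q] is known to vanish only for [t > 0]. *)
move=> t; rewrite le_eqVlt => /predU1P[<-//|t0].
apply/eqP; rewrite -subr_eq0 -/(dl t) -[dl t]mul1mx.
rewrite -(schur_decomposition schurE) mulmxDl -!mulmxA.
by rewrite -/(p t) -/(q t) p0 ?ltW// q0// !mulmx0 addr0.
Qed.

End PencilSolutions.

Theorem theorem4p4 (R : realType) (n : nat) (A E : 'M[R[i]]_n)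
    (AE_regular : regular_pencil A E)
    (AE_stable : forall lam : R[i],
       finite_eigenvalue A E lam -> complex.Re lam < 0)
    (mu : R[i]) (mu_unit : A - mu *: E \in unitmx)
    (d : nat) (d_lt_n : (d < n)%N)
    (Q : 'M[R[i]]_(n, n - d)) (Qt : 'M[R[i]]_(n, d))
    (G : 'M[R[i]]_(n - d)) (D : 'M[R[i]]_(n - d, d)) (N : 'M[R[i]]_d)
    (schurE : schur_splitting (shift_invert A E mu) Q Qt G D N)
    (eps : R) (eps_gt0 : 0 < eps) :
  (pencil_abscissa G mu eps * (eps^-1)%:E <=
     ereal_sup [set (opnorm (expmx (t%:C *: (invmx G + mu%:M))))%R%:E
               | t in [set t : R | (0 <= t)%R]])%E
  /\
  exists x0 : 'cV[R[i]]_n,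
    [/\ x0 != 0,
        exists y : 'cV[R[i]]_(n - d), x0 = Q *m y
      & exists x : R -> 'cV[R[i]]_n,
        [/\ dae_solution A E x,
            x 0 = x0,
            forall x' : R -> 'cV[R[i]]_n,
              dae_solution A E x' -> x' 0 = x0 ->
              forall t : R, 0 <= t -> x' t = x t
          & (pencil_abscissa G mu eps * (eps^-1)%:E <=
               ereal_sup [set (norm2 (x t) / norm2 x0)%R%:E
                         | t in [set t : R | (0 <= t)%R]])%E]].
Proof.
have dn := ltnW d_lt_n.
have nd0 : (0 < n - d)%N by rewrite subn_gt0.
(* One vector serves both claims: [opnorm] dominates each ratio along its orbit, and [Q *m y] starts
   a solution with the same ratios. *)
have [y y0 ysup] := abscissa_orbit nd0 (erefl (invmx G + mu%:M)) eps_gt0.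
have ratioQ (t : R) : norm2 (Q *m (expmx (t%:C *: (invmx G + mu%:M)) *m y)) / norm2 (Q *m y)
    = norm2 (expmx (t%:C *: (invmx G + mu%:M)) *m y) / norm2 y.
  by rewrite !(norm2_schur dn schurE).
split.
  apply: le_trans ysup _; apply: ge_ereal_sup => _ [t /= t0 <-].
  have : ((opnorm (expmx (t%:C *: (invmx G + mu%:M))))%:E <= ereal_sup
      [set (opnorm (expmx (s%:C *: (invmx G + mu%:M))))%:E
      | s in [set s : R | (0 <= s)%R]])%E by apply: ereal_sup_ubound; exists t.
  apply: le_trans.
  by rewrite lee_fin ler_pdivrMr ?norm2_gt0// norm2_mulmx_le_opnorm.
exists (Q *m y); split.
- by rewrite -norm2_gt0 (norm2_schur dn schurE) norm2_gt0.
- by exists y.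
- exists (fun t : R => Q *m (expmx (t%:C *: (invmx G + mu%:M)) *m y)).
  have xs := dae_solution_orbit mu_unit dn schurE y.
  have x0 : Q *m (expmx (0%:C *: (invmx G + mu%:M)) *m y) = Q *m y.
    by rewrite expmx0 mul1mx.
  split => //.
    move=> x' xs' x'0; apply: (dae_solution_unique mu_unit dn schurE xs xs').
    by rewrite x'0 x0.
  apply: le_trans ysup _; apply: ge_ereal_sup => _ [t /= t0 <-].
  by rewrite -ratioQ; apply: ereal_sup_ubound; exists t.
Qed.
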